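(* Let $H=G/K$ be a Riemannian homogeneous space of $G$, let $V:H\to\mathbb{R}$ be a potential function, $\tilde V=V\circ\pi$, and suppose $\mathfrak h=\mathfrak f\oplus\mathfrak d$. Let $\tilde u^{*}:\mathfrak d\to U$ be the unique control law making $\mathfrak d$ a virtual nonholonomic constraint. Then the trajectory $(g,\xi):[a,b]\to G\times\mathfrak g$, with $\xi(a)\in\mathfrak d$, of the closed-loop system $$\dot g=(T_eL_g)(\xi),\qquad \dot\xi+\tilde\nabla^{\mathfrak g}_{\xi}\xi+(T_gL_{g^{-1}})\big(\widetilde{\mathrm{grad}}\,\tilde V(g(t))\big)=\sum_{c=1}^m\tilde u^{*c}(\xi)f_c$$ is a trajectory of the equations $$\dot g=(T_eL_g)(\xi),\qquad \dot\xi+\tilde\nabla^{\mathfrak d,\mathfrak f}_{\xi}\xi+\mathfrak p_{\mathfrak d}\Big((T_gL_{g^{-1}})\big(\widetilde{\mathrm{grad}}\,\tilde V(g(t))\big)\Big)=0 .$$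
   Context: Setting. $G$ is a connected Lie group with identity $e$, Lie algebra $\mathfrak g=T_eG$ and left translations $L_g$. $K\subset G$ is a closed Lie subgroup with Lie algebra $\mathfrak s$, $H=G/K$, $\pi:G\to H$ is the canonical projection and $\Phi_g([h])=[gh]$ is the transitive left action of $G$ on $H$. $G$ carries a left-invariant Riemannian metric, determined by an inner product on $\mathfrak g$. Put $\mathrm{Ver}_g=\ker T_g\pi$ and $\mathrm{Hor}_g=\mathrm{Ver}_g^{\perp}$. $H$ carries a Riemannian metric such that $\pi$ is a Riemannian submersion, i.e. $T_g\pi:\mathrm{Hor}_g\to T_{\pi(g)}H$ is a linear isometry for all $g$; then $H$ is called a Riemannian homogeneous space. Put $\mathfrak h=\mathrm{Hor}_e=\mathfrak s^\perp$, so $\mathfrak g=\mathfrak s\oplus\mathfrak h$ and $\mathrm{Hor}_g=T_eL_g(\mathfrak h)$. $\tilde\nabla$ is the Levi-Civita connection of $G$ and $\widetilde{\mathrm{grad}}$ the gradient on $G$. For $\xi\in\mathfrak g$, $\xi_L(g)=T_eL_g(\xi)$, and the Riemannian $\mathfrak g$-connection is $\tilde\nabla^{\mathfrak g}_\xi\eta=(\tilde\nabla_{\xi_L}\eta_L)(e)$. Data of the control problem. $U\subset\mathbb R^m$ is the set of controls. $\mathcal D$ is a non-integrable distribution on $H$ that is $G$-invariant: $\mathcal D_{\Phi_g(\pi(e))}=T_{\pi(e)}\Phi_g(\mathcal D_{\pi(e)})$ for all $g\in G$; $\mathfrak d\subseteq\mathfrak h$ is the subspace with $T_e\pi(\mathfrak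 d)=\mathcal D_{\pi(e)}$. $Y_1,\dots,Y_m$ are $G$-invariant vector fields on $H$; $f_c\in\mathfrak h$ is defined by $T_e\pi(f_c)=Y_c(\pi(e))$; $\mathfrak f=\mathrm{span}\{f_1,\dots,f_m\}$, with $f_1,\dots,f_m$ a basis of $\mathfrak f$. Control law. A control law is a function $\tilde u:\mathfrak d\to U$ of $\xi$. It makes $\mathfrak d$ a virtual nonholonomic constraint for the system $\dot g=T_eL_g\xi$, $\dot\xi+\tilde\nabla^{\mathfrak g}_\xi\xi+T_gL_{g^{-1}}(\widetilde{\mathrm{grad}}\,\tilde V(g))=\sum_c\tilde u^cf_c$ if $\mathfrak d$ is invariant under the flow of the closed-loop system with $\tilde u^c=\tilde u^c(\xi(t))$, i.e. if $\xi(0)\in\mathfrak d$ then $\xi(t)\in\mathfrak d$ for all $t\ge0$. The paper's existence and uniqueness theorem asserts that, when $\mathfrak h=\mathfrak f\oplus\mathfrak d$, there is exactly one such control law; it is denoted $\tilde u^*$. Induced constrained connection. $\mathfrak p_{\mathfrak d}:\mathfrak g\to\mathfrak d$ and $\mathfrak p_{\mathfrak f}:\mathfrak g\to\mathfrak f\oplus\mathfrak s$ are the projections associated with the direct sum $\mathfrak g=\mathfrak d\oplus(\mathfrak f\oplus\mathfrak s)$. The bilinear map $\tilde\nabla^{\mathfrak d,\mathfrak f}:\mathfrak g\times\mathfrak g\to\mathfrak g$ is $$\tilde\nabla^{\mathfrak d,\mathfrak f}_\xi\eta=\tilde\nabla^{\mathfrak g}_\xi\eta+(\tilde\nabla^{\mathfrak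 g}_\xi\mathfrak p_{\mathfrak f})(\eta),\qquad(\tilde\nabla^{\mathfrak g}_\xi\mathfrak p_{\mathfrak f})(\eta)=\tilde\nabla^{\mathfrak g}_\xi(\mathfrak p_{\mathfrak f}\eta)-\mathfrak p_{\mathfrak f}(\tilde\nabla^{\mathfrak g}_\xi\eta).$$ *)

(* Defs.v *)
Set Warnings "-notation-overridden,-ambiguous-paths".
From HB Require Import structures.
From mathcomp Require Import all_boot all_order all_algebra.
From mathcomp Require Import all_classical all_reals all_analysis.

Set Implicit Arguments.
Unset Strict Implicit.
Unset Printing Implicit Defensive.

Import Order.TTheory GRing.Theory Num.Theory.
Import numFieldNormedType.Exports.

Local Open Scope classical_set_scope.
Local Open Scope ring_scope.

(* [smooth_on D f]: f is C^oo at the points of the open set D of R^n; [Ck] is *)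
(* iterated (total) differentiability of all iterated directional derivatives.*)
Section Smoothness.
Variables (R : realType) (n : nat) (W : normedModType R).

Fixpoint Ck (k : nat) (D : set 'rV[R]_n) (f : 'rV[R]_n -> W) : Prop :=
  if k is k'.+1 then
    (forall x, D x -> differentiable f x) /\ (forall v, Ck k' D ('D_v f))
  else forall x, D x -> {for x, continuous f}.

Definition smooth_on (D : set 'rV[R]_n) (f : 'rV[R]_n -> W) : Prop :=
  forall k, Ck k D f.

End Smoothness.

(* A chart is carried by total functions; only [coord] on [cdom] and [param]  *)
(* on [cimg] are meaningful.                                                  *)
Record chart (R : realType) (n : nat) (M : Type) := Chart {
  cdom : set M;
  coord : M -> 'rV[R]_n;
  param : 'rV[R]_n -> M }.

Definition cimg (R : realType) (n : nat) (M : Type) (c : chart R n M) :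
  set 'rV[R]_n := coord c @` cdom c.

Definition is_chart (R : realType) (n : nat) (M : topologicalType)
    (c : chart R n M) : Prop :=
  [/\ open (cdom c), open (cimg c),
      forall x, cdom c x -> param c (coord c x) = x,
      forall x, cdom c x -> {for x, continuous (coord c)}
    & forall y, cimg c y -> {for y, continuous (param c)}].

Definition chart_compat (R : realType) (n : nat) (M : Type)
    (c d : chart R n M) : Prop :=
  smooth_on (coord c @` (cdom c `&` cdom d)) (coord d \o param c).

HB.mixin Record isManifold (R : realType) (n : nat) M of Topological M := {
  atlas : set (chart R n M);
  atlas_chart : forall c, atlas c -> is_chart c;
  atlas_cover : forall x : M, exists2 c, atlas c & cdom c x;
  atlas_compat : forall c d, atlas c -> atlas d -> chart_compat c d;
  manifold_hausdorff : hausdorff_space M;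
  manifold_second_countable : @second_countable M
}.

#[short(type="manifoldType")]
HB.structure Definition Manifold (R : realType) (n : nat) :=
  { M of Topological M & isManifold R n M }.

(* Atlases rather than manifolds are the arguments, so that the product atlas *)
(* and open subsets of R^k can be used directly.                              *)
Definition smooth_map (R : realType) (m n : nat) (M N : topologicalType)
    (A : set (chart R m M)) (B : set (chart R n N)) (f : M -> N) : Prop :=
  (forall c x, A c -> cdom c x -> {for x, continuous f}) /\
  (forall c d, A c -> B d ->
     smooth_on (coord c @` (cdom c `&` f @^-1` cdom d))
               (coord d \o f \o param c)).

Definition prod_chart (R : realType) (m n : nat) (M N : Type)
    (c : chart R m M) (d : chart R n N) : chart R (m + n) (M * N) :=
  Chart [set p | cdom c p.1 /\ cdom d p.2]
        (fun p => row_mx (coord c p.1) (coord d p.2))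
        (fun z => (param c (lsubmx z), param d (rsubmx z))).

Definition prod_atlas (R : realType) (m n : nat) (M N : Type)
    (A : set (chart R m M)) (B : set (chart R n N)) :
    set (chart R (m + n) (M * N)) :=
  [set e | exists c d, [/\ A c, B d & e = prod_chart c d]].

Definition euclidean_atlas (R : realType) (k : nat) (W : set 'rV[R]_k) :
    set (chart R k 'rV[R]_k) := [set Chart W id id].

HB.mixin Record isLieGroup (R : realType) (n : nat) G
    of Group G & Manifold R n G := {
  mulg_smooth : smooth_map
    (prod_atlas (@atlas R n G) (@atlas R n G)) (@atlas R n G)
    (fun p : G * G => (p.1 * p.2)%g);
  invg_smooth : smooth_map (@atlas R n G) (@atlas R n G)
    (fun x : G => (x^-1)%g)
}.

#[short(type="lieGroupType")]
HB.structure Definition LieGroup (R : realType) (n : nat) :=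
  { G of Group G & Manifold R n G & isLieGroup R n G }.

(* Tangent vectors at p are the operators \sum_i w_i d/dx_i |_p on C^oo(M).   *)
(* To have them in one ambient vector space, they are functionals on all      *)
(* functions M -> R, taking the value 0 on functions that are not smooth.     *)
Notation functional M R := ((M -> R) -> R).

Section Tangent.
Variables (R : realType) (n : nat) (M : manifoldType R n).

Definition smooth_fun (phi : M -> R) : Prop :=
  forall c, @atlas R n M c -> smooth_on (cimg c) (phi \o param c).

Definition coord_deriv (c : chart R n M) (p : M) (w : 'rV[R]_n) :
    functional M R :=
  fun phi => if `[< smooth_fun phi >]
             then 'D_w (phi \o param c) (coord c p) else 0.

Definition tangent (p : M) : set (functional M R) :=
  [set v | exists c w,
     [/\ @atlas R n M c, cdom c p & v = coord_deriv c p w]].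

Definition smooth_field (X : M -> functional M R) : Prop :=
  (forall p, tangent p (X p)) /\
  (forall phi, smooth_fun phi -> smooth_fun (fun p => X p phi)).

Definition lie_bracket (X Y : M -> functional M R) : M -> functional M R :=
  fun p phi => X p (fun q => Y q phi) - Y p (fun q => X q phi).

(* gamma'(t) = v, for a curve considered on the interval I (one-sided at its  *)
(* endpoints).                                                                *)
Definition has_velocity (I : set R) (gamma : R -> M) (t : R)
    (v : functional M R) : Prop :=
  gamma s @[s --> within I (nbhs t)] --> gamma t /\
  (forall phi, smooth_fun phi ->
     (phi (gamma s) - phi (gamma t)) / (s - t) @[s --> within I t^']
       --> v phi).

End Tangent.

(* T_p f, which for functionals is the same formula at every p.               *)
Definition tmap (R : realType) (m n : nat) (M : manifoldType R m)
    (N : manifoldType R n) (f : M -> N) (v : functional M R) :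
    functional N R :=
  fun phi => if `[< smooth_fun phi >] then v (phi \o f) else 0.

Section LinearAlgebra.
Variables (R : realType) (V : lmodType R).

Definition is_subspace (A : set V) : Prop :=
  A 0 /\ forall (a : R) u v, A u -> A v -> A (a *: u + v).

Definition span_fam (k : nat) (f : 'I_k -> V) : set V :=
  [set v | exists a : 'I_k -> R, v = \sum_i a i *: f i].

Definition lin_indep (k : nat) (f : 'I_k -> V) : Prop :=
  forall a : 'I_k -> R, \sum_i a i *: f i = 0 -> forall i, a i = 0.

Definition sum_set (A B : set V) : set V := [set u + v | u in A & v in B].

Definition direct_sum (A B C : set V) : Prop :=
  A = sum_set B C /\ B `&` C = [set 0].

Definition projections (A B C : set V) (p q : V -> V) : Prop :=
  forall x, A x -> [/\ B (p x), C (q x) & x = p x + q x].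

End LinearAlgebra.

Section Riemannian.
Variables (R : realType) (n : nat) (M : manifoldType R n).
Implicit Types (X Y Z : M -> functional M R) (phi : M -> R).

Variable met : M -> functional M R -> functional M R -> R.

Definition riemannian_metric : Prop :=
  [/\ forall p u v, tangent p u -> tangent p v -> met p u v = met p v u,
      forall p (a : R) u v w, tangent p u -> tangent p v -> tangent p w ->
        met p (a *: u + v) w = a * met p u w + met p v w,
      forall p u, tangent p u -> u != 0 -> 0 < met p u u
    & forall X Y, smooth_field X -> smooth_field Y ->
        smooth_fun (fun p => met p (X p) (Y p))].

Definition met_norm (p : M) (v : functional M R) : R :=
  Num.sqrt (met p v v).

(* xi'(t) = zeta, for a curve xi in T_p M considered on the interval I        *)
Definition has_deriv (p : M) (I : set R) (xi : R -> functional M R) (t : R)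
    (zeta : functional M R) : Prop :=
  met_norm p ((s - t)^-1 *: (xi s - xi t) - zeta) @[s --> within I t^'] --> 0.

Definition affine_connection
    (nab : (M -> functional M R) -> (M -> functional M R) ->
           (M -> functional M R)) : Prop :=
  [/\ forall X Y, smooth_field X -> smooth_field Y -> smooth_field (nab X Y),
      forall phi X Y Z, smooth_fun phi ->
        smooth_field X -> smooth_field Y -> smooth_field Z ->
        forall p, nab (fun q => phi q *: X q + Y q) Z p =
                  phi p *: nab X Z p + nab Y Z p,
      forall X Y Z, smooth_field X -> smooth_field Y -> smooth_field Z ->
        forall p, nab X (fun q => Y q + Z q) p = nab X Y p + nab X Z p
    & forall phi X Y, smooth_fun phi -> smooth_field X -> smooth_field Y ->
        forall p, nab X (fun q => phi q *: Y q) p =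
                  X p phi *: Y p + phi p *: nab X Y p].

Definition levi_civita
    (nab : (M -> functional M R) -> (M -> functional M R) ->
           (M -> functional M R)) : Prop :=
  [/\ affine_connection nab,
      forall X Y, smooth_field X -> smooth_field Y ->
        forall p, nab X Y p - nab Y X p = lie_bracket X Y p
    & forall X Y Z, smooth_field X -> smooth_field Y -> smooth_field Z ->
        forall p, X p (fun q => met q (Y q) (Z q)) =
                  met p (nab X Y p) (Z p) + met p (Y p) (nab X Z p)].

Definition is_gradient (phi : M -> R) (X : M -> functional M R) : Prop :=
  forall p, tangent p (X p) /\
    forall v, tangent p v -> met p (X p) v = v phi.

End Riemannian.

Section Distributions.
Variables (R : realType) (n : nat) (M : manifoldType R n).

Definition is_distribution (r : nat) (D : M -> set (functional M R)) : Prop :=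
  forall x : M, exists X : 'I_r -> M -> functional M R,
    (forall i, smooth_field (X i)) /\
    \forall y \near x, lin_indep (X^~ y) /\ D y = span_fam (X^~ y).

(* Integral manifold through every point: F parametrizes it near x, and       *)
(* {w |-> d/dw (- \o F)} is the tangent map of F at y. As dim D = r, F is     *)
(* automatically an immersion.                                                *)
Definition integrable_distribution (r : nat)
    (D : M -> set (functional M R)) : Prop :=
  forall x, exists (W : set 'rV[R]_r) (F : 'rV[R]_r -> M),
    [/\ open W, W 0, F 0 = x,
        smooth_map (euclidean_atlas W) (@atlas R n M) F
      & forall y, W y ->
          D (F y) = [set v | exists w : 'rV[R]_r,
            v = fun phi => if `[< smooth_fun phi >]
                           then 'D_w (phi \o F) y else 0]].

End Distributions.

Section LieGroups.
Variables (R : realType) (n : nat) (G : lieGroupType R n).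

Definition closed_subgroup (K : set G) : Prop :=
  [/\ closed K, K 1%g & forall x y, K x -> K y -> K (x^-1 * y)%g].

(* T_e K, by velocities of curves of G lying in the (embedded) subgroup K     *)
Definition lie_algebra (K : set G) : set (functional G R) :=
  [set v | tangent 1%g v /\ exists gamma : R -> G,
     [/\ gamma 0 = 1%g, forall t, K (gamma t)
       & has_velocity setT gamma 0 v]].

(* The tangent map of L_g; the base point is that of v.                       *)
Definition tleft (g : G) (v : functional G R) : functional G R :=
  tmap (fun h : G => (g * h)%g) v.

Definition left_field (xi : functional G R) : G -> functional G R :=
  fun g => tleft g xi.

Definition left_invariant (met : G -> functional G R -> functional G R -> R) :
    Prop :=
  forall g h u v, tangent h u -> tangent h v ->
    met (g * h)%g (tleft g u) (tleft g v) = met h u v.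

Definition lie_conn
    (nab : (G -> functional G R) -> (G -> functional G R) ->
           (G -> functional G R)) (xi eta : functional G R) :
    functional G R :=
  nab (left_field xi) (left_field eta) 1%g.

Definition constrained_conn
    (nabg : functional G R -> functional G R -> functional G R)
    (pf : functional G R -> functional G R) (xi eta : functional G R) :
    functional G R :=
  nabg xi eta + (nabg xi (pf eta) - pf (nabg xi eta)).

(* Solutions (g, xi) : [a, b] -> G x T_e G of  g' = T_e L_g xi  together with *)
(* an equation E g xi xi' for the derivative of xi.                           *)
Definition trajectory (met : G -> functional G R -> functional G R -> R)
    (E : G -> functional G R -> functional G R -> Prop) (a b : R)
    (g : R -> G) (xi : R -> functional G R) : Prop :=
  forall t, `[a, b]%classic t ->
    [/\ tangent 1%g (xi t),
        has_velocity `[a, b]%classic g t (tleft (g t) (xi t))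
      & exists dxi, [/\ tangent 1%g dxi,
          has_deriv met 1%g `[a, b]%classic xi t dxi
        & E (g t) (xi t) dxi]].

(* Feedback laws are total functions of xi; their values are required to be   *)
(* controls on the subspace d only.                                           *)
Definition control_law (m : nat) (U : set 'rV[R]_m)
    (d : set (functional G R)) (u : functional G R -> 'rV[R]_m) : Prop :=
  forall xi, d xi -> U (u xi).

Definition closed_loop_eq (m : nat)
    (nabg : functional G R -> functional G R -> functional G R)
    (gradV : G -> functional G R) (f : 'I_m -> functional G R)
    (u : functional G R -> 'rV[R]_m)
    (g : G) (xi dxi : functional G R) : Prop :=
  dxi + nabg xi xi + tleft (g^-1)%g (gradV g) = \sum_c u xi 0 c *: f c.

Definition constrained_eq
    (nabdf : functional G R -> functional G R -> functional G R)
    (gradV : G -> functional G R) (pd : functional G R -> functional G R)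
    (g : G) (xi dxi : functional G R) : Prop :=
  dxi + nabdf xi xi + pd (tleft (g^-1)%g (gradV g)) = 0.

(* Invariance of d under the flow of the system E: the flow is defined (for   *)
(* some positive time) from all initial states with xi(0) in d, and every     *)
(* trajectory issued from such a state keeps xi in d as long as it exists.    *)
(* Without the first clause, feedback laws for which the closed-loop system   *)
(* has no solutions at all would qualify, and uniqueness would be lost.       *)
Definition flow_invariant (met : G -> functional G R -> functional G R -> R)
    (d : set (functional G R))
    (E : G -> functional G R -> functional G R -> Prop) : Prop :=
  (forall g0 xi0, d xi0 -> exists T g xi,
     [/\ 0 < T, trajectory met E 0 T g xi, g 0 = g0 & xi 0 = xi0]) /\
  (forall T g xi, 0 < T -> trajectory met E 0 T g xi -> d (xi 0) ->
     forall t, `[0, T]%classic t -> d (xi t)).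

End LieGroups.

Section Homogeneous.
Variables (R : realType) (n k : nat).
Variables (G : lieGroupType R n) (H : manifoldType R k).
Variables (K : set G) (pi : G -> H).

(* H with pi is the quotient manifold G/K: the fibres of pi are the left      *)
(* cosets of K, and the smooth structure is the (unique) one for which pi is  *)
(* a smooth submersion.                                                       *)
Definition quotient_manifold : Prop :=
  [/\ forall x, exists g, pi g = x,
      forall g h, pi g = pi h <-> K (g^-1 * h)%g,
      smooth_map (@atlas R n G) (@atlas R k H) pi
    & forall g, tmap pi @` tangent g = tangent (pi g)].

Definition left_action (g : G) (x : H) : H :=
  pi (g * xget 1%g [set h | pi h = x])%g.

Definition vertical (g : G) : set (functional G R) :=
  [set v | tangent g v /\ tmap pi v = 0].

Definition horizontal (met : G -> functional G R -> functional G R -> R)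
    (g : G) : set (functional G R) :=
  [set v | tangent g v /\ forall w, vertical g w -> met g v w = 0].

Definition riemannian_submersion
    (metG : G -> functional G R -> functional G R -> R)
    (metH : H -> functional H R -> functional H R -> R) : Prop :=
  forall g, tmap pi @` horizontal metG g = tangent (pi g) /\
    forall u v, horizontal metG g u -> horizontal metG g v ->
      metH (pi g) (tmap pi u) (tmap pi v) = metG g u v.

Definition invariant_field (Y : H -> functional H R) : Prop :=
  forall g x, tmap (left_action g) (Y x) = Y (left_action g x).

Definition invariant_distribution (D : H -> set (functional H R)) : Prop :=
  forall g, D (left_action g (pi 1%g)) =
            tmap (left_action g) @` D (pi 1%g).

End Homogeneous.

(* Main.v *)
Require Import Defs.
Set Warnings "-notation-overridden,-ambiguous-paths".
From HB Require Import structures.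
From mathcomp Require Import all_boot all_order all_algebra.
From mathcomp Require Import all_classical all_reals all_analysis.
From mathcomp Require Import ring.

(* A state in d stays in d, and d is finite dimensional: T_e pi is injective on
   horizontal vectors and the distribution D has a local frame. A difference
   quotient of xi therefore never comes closer to the derivative than the
   orthogonal projection of the derivative onto d does, so the derivative lies
   in d as well. The d-component of the closed-loop equation along
   d (+) (f (+) s) is then the constrained equation, because p_f xi = 0 kills
   the term nabla_xi (p_f xi). *)

Set Implicit Arguments.
Unset Strict Implicit.
Unset Printing Implicit Defensive.

Import Order.TTheory GRing.Theory Num.Theory.
Import numFieldNormedType.Exports.

Local Open Scope classical_set_scope.
Local Open Scope ring_scope.

(** * Calculus of C^k maps *)

(** The first-order expansion of [f] at [x] is also one of [g], and an expansion with continuous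
    linear part determines the differential; hence ['d g x] is ['d f x]. *)
Lemma near_eq_differentiable (R : numFieldType) (V W : normedModType R)
    (f g : V -> W) (x : V) :
  {near x, f =1 g} -> differentiable f x -> differentiable g x.
Proof.
move=> fg df; have /diff_locallyP [dfc /eqaddoP dfo] := df.
have dgo : g \o shift x = cst (g x) + 'd f x +o_ (0 : V) id.
  apply/eqaddoP => e e0; have := dfo e e0.
  have fg0 : \forall h \near (0 : V), f (h + x) = g (h + x).
    by move: fg; rewrite (near_shift 0) /= subr0.
  rewrite -(nbhs_singleton fg); apply: filterS2 fg0 => h /= fgh.
  by rewrite !fctE /= fgh.
have dgE := diff_unique dfc dgo.
by apply/diff_locallyP; split; rewrite dgE.
Qed.

Section CkCalculus.
Variables (R : realType) (n : nat).

(** Openness of [D] turns agreement on [D] into agreement near each of its points, which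
    differentials and directional derivatives respect. Sum, product and chain rules, valid only on
    [D], can then replace the derivatives below. *)
Lemma Ck_eq (W : normedModType R) k (D : set 'rV[R]_n) (f g : 'rV[R]_n -> W) :
  open D -> (forall x, D x -> f x = g x) -> Ck k D f -> Ck k D g.
Proof.
move=> oD; have eqn (f1 g1 : 'rV[R]_n -> W) x : (forall x, D x -> f1 x = g1 x) -> D x ->
    {near x, f1 =1 g1}.
  by move=> fg Dx; apply: filterS (open_nbhs_nbhs (conj oD Dx)) => y; apply: fg.
elim: k f g => [|k IH] f g fg /=.
  move=> cf x Dx; have := cf x Dx.
  rewrite /prop_for /continuous_at -(fg x Dx); apply: cvg_trans.
  by apply: (@near_eq_cvg _ _ (nbhs x)); exact: (eqn f g x fg Dx).
move=> [df Df]; split=> [x Dx|v].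
  by apply: near_eq_differentiable (df x Dx); exact: eqn.
by apply: IH (Df v) => x Dx; apply: near_eq_derive; exact: (eqn f g).
Qed.

Lemma CkW (W : normedModType R) k (D : set 'rV[R]_n) (f : 'rV[R]_n -> W) :
  Ck k.+1 D f -> Ck k D f.
Proof.
elim: k f => [|k IH] f [df Df]; first by move=> x /df /differentiable_continuous.
by split=> // v; apply/IH/Df.
Qed.

Lemma Ck_cst (W : normedModType R) k (D : set 'rV[R]_n) (c : W) :
  Ck k D (fun=> c).
Proof.
elim: k c => [|k IH] c; first by move=> x _; exact: cst_continuous.
split=> [x _|v]; first exact: differentiable_cst.
have -> : 'D_v (fun=> c : W) = (fun=> 0) by apply/funext => x; exact: derive_cst.
exact: IH.
Qed.

Lemma CkD (W : normedModType R) k (D : set 'rV[R]_n) (f g : 'rV[R]_n -> W) :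
  open D -> Ck k D f -> Ck k D g -> Ck k D (f + g).
Proof.
move=> oD; elim: k f g => [|k IH] f g.
  by move=> cf cg x Dx; apply: continuousD; [exact: cf|exact: cg].
move=> [df Df] [dg Dg]; split=> [x Dx|v].
  by apply: differentiableD; [exact: df|exact: dg].
apply: Ck_eq (IH _ _ (Df v) (Dg v)) => // x Dx.
by rewrite deriveD //; apply: diff_derivable; [exact: df|exact: dg].
Qed.

Lemma Ck_sum (W : normedModType R) k (D : set 'rV[R]_n) (I : Type) (s : seq I)
    (f : I -> 'rV[R]_n -> W) :
  open D -> (forall i, Ck k D (f i)) -> Ck k D (\sum_(i <- s) f i).
Proof.
move=> oD Cf; elim/big_rec: _ => [|i g _ Cg]; first exact: Ck_cst.
exact: CkD.
Qed.

Lemma CkM k (D : set 'rV[R]_n) (f g : 'rV[R]_n -> R) :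
  open D -> Ck k D f -> Ck k D g -> Ck k D (f * g).
Proof.
move=> oD; elim: k f g => [|k IH] f g.
  by move=> cf cg x Dx; apply: continuousM; [exact: cf|exact: cg].
move=> Cf Cg; have [df Df] := Cf; have [dg Dg] := Cg; split=> [x Dx|v].
  by apply: differentiableM; [exact: df|exact: dg].
(* In each term of the product rule the undifferentiated factor is lowered from order [k.+1] to
   order [k]. *)
apply: Ck_eq (CkD oD (IH _ _ (CkW Cf) (Dg v)) (IH _ _ (CkW Cg) (Df v))) => // x Dx.
by rewrite deriveM //; apply: diff_derivable; [exact: df|exact: dg].
Qed.

Lemma Ck_comp_coordinate k p (D : set 'rV[R]_n) (g : 'rV[R]_n -> 'rV[R]_p) j :
  open D -> Ck k D g -> Ck k D (fun x => g x 0 j).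
Proof.
move=> oD; elim: k g => [|k IH] g.
  move=> cg x Dx.
  apply: (@continuous_comp _ _ _ g (fun M : 'rV[R]_p => M 0 j)).
    exact: cg.
  exact: coord_continuous.
move=> [dg Dg]; split=> [x Dx|v].
  apply: (@differentiable_comp _ _ _ _ g (fun M : 'rV[R]_p => M 0 j)).
    exact: dg.
  exact: differentiable_coord.
apply: Ck_eq (IH _ (Dg v)) => // x Dx.
by rewrite derive_mx ?mxE //; apply/diff_derivable/dg.
Qed.

End CkCalculus.

(** The chain rule as a finite sum over coordinates, the form that the induction on the order in
    [Ck_comp] can digest. *)
Lemma derive_comp_coordinate (R : realType) n p (W : normedModType R)
    (f : 'rV[R]_p -> W) (g : 'rV[R]_n -> 'rV[R]_p) x v :
  differentiable g x -> differentiable f (g x) ->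
  'D_v (f \o g) x =
  \sum_j 'D_v (fun y => g y 0 j) x *: 'D_(delta_mx 0 j) f (g x).
Proof.
move=> dg df; rewrite deriveE; last exact: differentiable_comp.
rewrite diff_comp //= -[in LHS](deriveE v dg) [in LHS](row_sum_delta ('D_v g x)).
rewrite linear_sum; apply: eq_bigr => j _; rewrite linearZ /= (deriveE _ df).
by rewrite derive_mx ?mxE //; apply: diff_derivable.
Qed.

(** Regularity of [g] is asked of its scalar coordinates, since the chain rule makes a derivative of
    [f \o g] a sum of products of scalar functions. The induction generalises [f], whose partial
    derivatives take its place; differentiability of [g] is a separate hypothesis because it is used
    at every order. *)
Lemma Ck_comp (R : realType) n p k (D : set 'rV[R]_n) (E : set 'rV[R]_p)
    (f : 'rV[R]_p -> R) (g : 'rV[R]_n -> 'rV[R]_p) :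
  open D -> (forall x, D x -> E (g x)) -> (forall x, D x -> differentiable g x) ->
  (forall j, Ck k D (fun x => g x 0 j)) -> Ck k E f -> Ck k D (f \o g).
Proof.
move=> oD DE dg; elim: k f => [|k IH] f Cg.
  move=> cf x Dx; apply: continuous_comp; last exact/cf/DE.
  exact/differentiable_continuous/dg.
move=> [df Df]; split=> [x Dx|v].
  by apply: differentiable_comp; [exact: dg|exact/df/DE].
pose h := \sum_j 'D_v (fun y => g y 0 j) * ('D_(delta_mx 0 j) f \o g).
apply: (@Ck_eq _ _ _ _ _ h) => // [x Dx|].
  rewrite derive_comp_coordinate; [|exact: dg|exact/df/DE].
  by rewrite /h fct_sumE.
apply: Ck_sum => // j; apply: CkM => //; first by have [_] := Cg j; exact.
by apply: IH => [i|]; [exact: CkW|exact: Df].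
Qed.

Lemma smooth_comp (R : realType) n p (D : set 'rV[R]_n) (E : set 'rV[R]_p)
    (f : 'rV[R]_p -> R) (g : 'rV[R]_n -> 'rV[R]_p) :
  open D -> (forall x, D x -> E (g x)) ->
  smooth_on D g -> smooth_on E f -> smooth_on D (f \o g).
Proof.
move=> oD DE sg sf k; apply: Ck_comp (sf k) => //.
  by have [] := sg 1%N.
by move=> j; apply: Ck_comp_coordinate.
Qed.

(** * Charts and smooth maps *)

(** [Ck] tests pointwise properties of functions defined on the whole space, so it may be verified
    with a different set [E] at each point. *)
Lemma Ck_local (R : realType) n (W : normedModType R) k (D : set 'rV[R]_n)
    (f : 'rV[R]_n -> W) :
  (forall x, D x -> exists2 E, E x & Ck k E f) -> Ck k D f.
Proof.
elim: k f => [|k IH] f Df; first by move=> x /Df [E Ex]; apply.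
split=> [x /Df [E Ex [df _]]|v]; first exact: df.
by apply: IH => x /Df [E Ex [_ Dv]]; exists E => //; exact: Dv.
Qed.

Lemma continuous_pair (T U V : topologicalType) (f : T -> U) (g : T -> V) x :
  {for x, continuous f} -> {for x, continuous g} ->
  {for x, continuous (fun y => (f y, g y))}.
Proof. by move=> cf cg; apply: cvg_pair. Qed.

Lemma continuous_row_mx (R : realType) m n :
  continuous (fun p : 'rV[R]_m * 'rV[R]_n => row_mx p.1 p.2).
Proof.
move=> [u v] A /nbhs_ballP[e /= e0 eA]; apply/nbhs_ballP; exists e => //=.
move=> [u' v'] [[_ uu'] [_ vv']]; apply: eA; split=> // i j /=.
by rewrite !mxE; case: (fintype.split j) => l.
Qed.

(** The directional derivative along [v] is the constant [A v], so only constants remain from order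
    one on. Continuity of [A], required for its differentiability, is inherited from [f]. *)
Lemma smooth_affine (R : realType) n (W : normedModType R) (f : 'rV[R]_n -> W)
    (A : {linear 'rV[R]_n -> W}) (c : W) (D : set 'rV[R]_n) :
  continuous f -> (forall x, f x = A x + c) -> smooth_on D f.
Proof.
move=> cf fE k; have AE x : A x = f x - c by rewrite fE addrK.
have cA : continuous A.
  have -> : A = f - cst c :> ('rV[R]_n -> W) by apply/funext => x; rewrite AE.
  by move=> x; apply: continuousB; [exact: cf|exact: cst_continuous].
pose A' : 'rV[R]_n -> W := A; have -> : f = A' + cst c by apply/funext => x; rewrite fE.
have dA x : differentiable (A' + cst c) x.
  by apply: differentiableD => //; exact: linear_differentiable.
case: k => [|k] /=; first by move=> x _; exact: differentiable_continuous.
split=> [x _|v]; first exact: dA.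
have -> : 'D_v (A' + cst c) = (fun=> A v); last exact: Ck_cst.
apply/funext => x; rewrite deriveE // diffD //=; last exact: linear_differentiable.
by rewrite diff_cst diff_lin //= addr0.
Qed.

Lemma smooth_row_mxl (R : realType) m n (v : 'rV[R]_n) (D : set 'rV[R]_m) :
  smooth_on D (fun u => row_mx u v).
Proof.
apply: (@smooth_affine _ _ _ _ (mulmxr (row_mx 1%:M 0)) (row_mx 0 v)) => u.
  apply: (continuous_comp (f := fun u => (u, v))
    (g := fun p : 'rV[R]_m * 'rV[R]_n => row_mx p.1 p.2)).
    by apply: continuous_pair; [exact: cvg_id|exact: cst_continuous].
  exact: continuous_row_mx.
by rewrite /= mul_mx_row mulmx1 mulmx0 add_row_mx addr0 add0r.
Qed.

Lemma smooth_row_mxr (R : realType) m n (u : 'rV[R]_m) (D : set 'rV[R]_n) :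
  smooth_on D (fun v => row_mx u v).
Proof.
apply: (@smooth_affine _ _ _ _ (mulmxr (row_mx 0 1%:M)) (row_mx u 0)) => v.
  apply: (continuous_comp (f := fun v => (u, v))
    (g := fun p : 'rV[R]_m * 'rV[R]_n => row_mx p.1 p.2)).
    by apply: continuous_pair; [exact: cst_continuous|exact: cvg_id].
  exact: continuous_row_mx.
by rewrite /= mul_mx_row mulmx1 mulmx0 add_row_mx addr0 add0r.
Qed.

Local Notation coord := Defs.coord.

Section Charts.
Variables (R : realType) (n : nat) (M : topologicalType) (c : chart R n M).
Hypothesis chart_c : is_chart c.

(** Inside the open set [cimg c], every point that the continuous map [param c] sends into [B]
    belongs to the image. *)
Lemma chart_image_open (B : set M) :
  B `<=` cdom c -> open B -> open (coord c @` B).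
Proof.
have [oc oi pK _ cp] := chart_c => Bc oB; rewrite openE => _ [x Bx <-].
have ix : cimg c (coord c x) by exists x => //; exact: Bc.
have nB : nbhs (param c (coord c x)) B.
  by rewrite pK; [exact: open_nbhs_nbhs|exact: Bc].
have ni : nbhs (coord c x) (cimg c) by exact: open_nbhs_nbhs.
apply: (@filterS _ (nbhs (coord c x)) _ _ _ _ (filterI ni (cp _ ix B nB))).
move=> y [[z cz zy] By]; exists (param c y) => //.
by rewrite -zy pK.
Qed.

Lemma chart_preimage_open (N : topologicalType) (f : M -> N) (B : set N) :
  (forall x, cdom c x -> {for x, continuous f}) -> open B ->
  open (coord c @` (cdom c `&` f @^-1` B)).
Proof.
have [oc _ _ _ _] := chart_c => cf oB; apply: chart_image_open => [x []//|].
rewrite openE => x [cx Bx]; rewrite /interior; apply: filterI.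
  exact: open_nbhs_nbhs.
exact/(cf x cx)/open_nbhs_nbhs.
Qed.

End Charts.

Lemma prod_is_chart (R : realType) m n (M N : topologicalType)
    (c : chart R m M) (e : chart R n N) :
  is_chart c -> is_chart e -> is_chart (prod_chart c e).
Proof.
move=> [oc ic pc cc kc] [oe ie pe ce ke]; split.
- rewrite openE => -[x y] [/= cx ey]; exists (cdom c, cdom e) => //=.
  by split; apply: open_nbhs_nbhs.
- have -> : cimg (prod_chart c e) = lsubmx @^-1` cimg c `&` rsubmx @^-1` cimg e.
    apply/seteqP; split=> [_ [[x y] [/= cx ey] <-]|z [[x cx xz] [y ey yz]]].
      by rewrite /= row_mxKl row_mxKr; split; [exists x|exists y].
    by exists (x, y) => //=; rewrite xz yz hsubmxK.
  apply: openI; apply: open_comp => // z _.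
    exact: continuous_lsubmx.
  exact: continuous_rsubmx.
- by move=> [x y] [/= cx ey]; rewrite row_mxKl row_mxKr pc // pe.
- move=> [x y] [/= cx ey].
  apply: (@continuous_comp _ _ _ (fun p => (coord c p.1, coord e p.2))
    (fun p => row_mx p.1 p.2)); last exact: continuous_row_mx.
  apply: continuous_pair; apply: continuous_comp.
  - exact: cvg_fst.
  - exact: cc.
  - exact: cvg_snd.
  - exact: ce.
- move=> _ [[x y] [/= cx ey] <-].
  apply: continuous_pair.
    apply: (@continuous_comp _ _ _ lsubmx (param c)); first exact: continuous_lsubmx.
    by rewrite row_mxKl; apply: kc; exists x.
  apply: (@continuous_comp _ _ _ rsubmx (param e)); first exact: continuous_rsubmx.
  by rewrite row_mxKr; apply: ke; exists y.
Qed.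

(** Around [f x] a chart [d] of [N] splits the composite into [phi \o param d] and the coordinate
    expression of [f]; as [d] depends on [x], the argument is local. The source carries an arbitrary
    atlas so that products of charts are covered. *)
Lemma smooth_fun_comp (R : realType) m n (M : topologicalType)
    (N : manifoldType R n) (A : set (chart R m M)) (f : M -> N) (phi : N -> R) c :
  smooth_map A (@atlas R n N) f -> smooth_fun phi -> A c -> is_chart c ->
  smooth_on (cimg c) (phi \o f \o param c).
Proof.
move=> [cf sf] sphi Ac cc k; apply: Ck_local => _ [x cx <-].
have [d Ad dfx] := @atlas_cover R n N (f x).
have [od _ pd _ _] := atlas_chart d Ad; have [_ _ pc _ _] := cc.
have oE := chart_preimage_open cc (fun x => cf c x Ac) od.
exists (coord c @` (cdom c `&` f @^-1` cdom d)); first by exists x.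
apply: Ck_eq (smooth_comp oE _ (sf c d Ac Ad) (sphi d Ad) k) => //.
  by move=> _ [y [cy dy] <-] /=; rewrite pc // pd.
by move=> _ [y [cy dy] <-]; exists (f y) => //=; rewrite pc.
Qed.

(** * Tangent spaces and left translations *)

Lemma smooth_on_differentiable (R : realType) n (W : normedModType R)
    (D : set 'rV[R]_n) (f : 'rV[R]_n -> W) x :
  smooth_on D f -> D x -> differentiable f x.
Proof. by move=> sf Dx; have [df _] := sf 1%N; exact: df. Qed.

Lemma smooth_fun_differentiable (R : realType) n (M : manifoldType R n)
    (phi : M -> R) (c : chart R n M) p :
  smooth_fun phi -> @atlas R n M c -> cdom c p ->
  differentiable (phi \o param c) (coord c p).
Proof.
by move=> sphi Ac cp; apply: smooth_on_differentiable (sphi c Ac) _; exists p.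
Qed.

Section TangentSpaces.
Variables (R : realType) (n : nat) (M : manifoldType R n).
Implicit Types (c d : chart R n M) (p : M).

Lemma coord_deriv_linear c p (a : R) u v :
  @atlas R n M c -> cdom c p ->
  coord_deriv c p (a *: u + v) = a *: coord_deriv c p u + coord_deriv c p v.
Proof.
move=> Ac cp; apply/funext => phi; rewrite /coord_deriv !fctE.
case: asboolP => [sphi|_]; last by rewrite scaler0 addr0.
have dphi := smooth_fun_differentiable sphi Ac cp.
by rewrite !deriveE // linearP.
Qed.

(** By continuity [f (param c y)] stays in [cdom d] for [y] near [coord c p], so
    [phi \o f \o param c] factors there through the chart [d] and the ordinary chain rule
    applies. *)
Lemma tmap_coord_deriv m (N : manifoldType R m) (f : M -> N) c
    (d : chart R m N) p w :
  @atlas R n M c -> @atlas R m N d -> cdom c p -> cdom d (f p) ->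
  {for p, continuous f} ->
  (forall phi : N -> R, smooth_fun phi -> smooth_fun (phi \o f)) ->
  differentiable (coord d \o f \o param c) (coord c p) ->
  tmap f (coord_deriv c p w) =
  coord_deriv d (f p) ('D_w (coord d \o f \o param c) (coord c p)).
Proof.
move=> Ac Ad cp dp cf sf dh; apply/funext => phi; rewrite /tmap /coord_deriv.
case: asboolP => // sphi; rewrite asboolT; last exact: sf.
have [_ _ pc _ kc] := atlas_chart c Ac; have [od _ pd _ _] := atlas_chart d Ad.
have near_d : \forall y \near coord c p, cdom d (f (param c y)).
  have cfp : {for coord c p, continuous (f \o param c)}.
    by apply: continuous_comp; [apply: kc; exists p|rewrite pc].
  by apply: cfp; rewrite /= pc //; exact: open_nbhs_nbhs.
have hp : (coord d \o f \o param c) (coord c p) = coord d (f p) by rewrite /= pc.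
have dphi : differentiable (phi \o param d) ((coord d \o f \o param c) (coord c p)).
  by rewrite hp; exact: smooth_fun_differentiable.
rewrite -hp (deriveE w dh) (deriveE _ dphi).
rewrite -[RHS]/(('d (phi \o param d) ((coord d \o f \o param c) (coord c p)) \o
  'd (coord d \o f \o param c) (coord c p)) w).
rewrite -diff_comp // -deriveE; last exact: differentiable_comp.
by apply: near_eq_derive; apply: filterS near_d => y dy /=; rewrite pd.
Qed.

(** A change of charts is the coordinate expression of the identity, so this is the tangent map of
    [id] in two charts. *)
Lemma tangent_chart p v c :
  tangent p v -> @atlas R n M c -> cdom c p -> exists w, v = coord_deriv c p w.
Proof.
move=> [d [w [Ad dp ->]]] Ac cp.
have dh : differentiable (coord c \o id \o param d) (coord d p).
  apply: smooth_on_differentiable (atlas_compat d c Ad Ac) _.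
  by exists p.
have := tmap_coord_deriv (f := id) w Ad Ac dp cp (@cvg_id _ _) (fun _ => id) dh.
move=> E; exists ('D_w (coord c \o id \o param d) (coord d p)).
rewrite -E; apply/funext => phi.
by rewrite /tmap /coord_deriv; case: asboolP.
Qed.

Lemma tangent_subspace p : is_subspace (tangent p : set (functional M R)).
Proof.
have [c Ac cp] := @atlas_cover R n M p; split.
  exists c, 0; split => //; apply/funext => phi; rewrite /coord_deriv derive0.
  by case: asboolP.
move=> a u v /tangent_chart /(_ Ac cp) [x ->] /tangent_chart /(_ Ac cp) [y ->].
by exists c, (a *: x + y); split => //; rewrite coord_deriv_linear.
Qed.

End TangentSpaces.

Lemma derive_row_mxr (R : realType) m n (F : 'rV[R]_(m + n) -> R) y z w :
  'D_(row_mx 0 w) F (row_mx y z) = 'D_w (fun z => F (row_mx y z)) z.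
Proof.
rewrite /derive; congr (lim _).
apply: (congr1 (fun f : R -> R => f @ 0^')); apply/funext => h /=.
by rewrite scale_row_mx add_row_mx scaler0 add0r.
Qed.

Section LeftTranslation.
Variables (R : realType) (n : nat) (G : lieGroupType R n).
Implicit Types (c d e : chart R n G) (p x : G) (phi : G -> R).

Lemma continuous_mulg p x : {for (p, x), continuous (fun q : G * G => (q.1 * q.2)%g)}.
Proof.
have [e Ae ep] := @atlas_cover R n G p; have [c Ac cx] := @atlas_cover R n G x.
have [cm _] := @mulg_smooth R n G.
by apply: (cm (prod_chart e c)) => //; exists e, c.
Qed.

Lemma continuous_mulgl p x : {for x, continuous (fun h : G => (p * h)%g)}.
Proof.
apply: (continuous_comp (f := fun h => (p, h)) (g := fun q => (q.1 * q.2)%g)).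
  by apply: continuous_pair; [exact: cst_continuous|exact: cvg_id].
exact: continuous_mulg.
Qed.

Lemma smooth_fun_mulg phi e c :
  smooth_fun phi -> @atlas R n G e -> @atlas R n G c ->
  smooth_on (cimg (prod_chart e c))
    (phi \o (fun q : G * G => (q.1 * q.2)%g) \o param (prod_chart e c)).
Proof.
move=> sphi Ae Ac; apply: smooth_fun_comp (@mulg_smooth R n G) sphi _ _.
  by exists e, c.
by apply: prod_is_chart; exact: atlas_chart.
Qed.

Lemma cimg_prod e c p x :
  cdom e p -> cdom c x -> cimg (prod_chart e c) (row_mx (coord e p) (coord c x)).
Proof. by move=> ep cx; exists (p, x). Qed.

(** Left translation by [p] is multiplication restricted to the slice over [p]: the first block of a
    product chart is frozen at [coord e p]. *)
Lemma smooth_fun_mulgl p phi :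
  smooth_fun phi -> smooth_fun (fun x => phi (p * x)%g).
Proof.
move=> sphi c Ac; have [e Ae ep] := @atlas_cover R n G p.
have [_ ic _ _ _] := atlas_chart c Ac; have [_ _ pe _ _] := atlas_chart e Ae.
have -> : (fun x => phi (p * x)%g) \o param c =
    (phi \o (fun q : G * G => (q.1 * q.2)%g) \o param (prod_chart e c)) \o
    (fun z => row_mx (coord e p) z).
  by apply/funext => z /=; rewrite row_mxKl row_mxKr pe.
apply: smooth_comp (smooth_fun_mulg sphi Ae Ac) => //.
  by move=> _ [x cx <-]; exact: cimg_prod.
exact: smooth_row_mxr.
Qed.

Lemma differentiable_mulgl p x c d :
  @atlas R n G c -> @atlas R n G d -> cdom c x -> cdom d (p * x)%g ->
  differentiable (coord d \o (fun h : G => (p * h)%g) \o param c) (coord c x).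
Proof.
move=> Ac Ad cx dpx; have [e Ae ep] := @atlas_cover R n G p.
have [_ _ pe _ _] := atlas_chart e Ae.
have -> : coord d \o (fun h : G => (p * h)%g) \o param c =
    (coord d \o (fun q : G * G => (q.1 * q.2)%g) \o param (prod_chart e c)) \o
    (fun z => row_mx (coord e p) z).
  by apply/funext => z /=; rewrite row_mxKl row_mxKr pe.
apply: differentiable_comp.
  exact: smooth_on_differentiable (@smooth_row_mxr _ _ _ _ setT) _.
have [_ sm] := @mulg_smooth R n G.
apply: smooth_on_differentiable (sm (prod_chart e c) d _ Ad) _; first by exists e, c.
by exists (p, x).
Qed.

Lemma tangent_tleft p x v : tangent x v -> tangent (p * x)%g (tleft p v).
Proof.
move=> [c [w [Ac cx ->]]]; have [d Ad dpx] := @atlas_cover R n G (p * x)%g.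
eexists d, _; split => //; apply: tmap_coord_deriv => //.
- exact: continuous_mulgl.
- by move=> phi; exact: smooth_fun_mulgl.
- exact: differentiable_mulgl.
Qed.

(** In a product chart, the left-invariant field applied to [phi] is the partial derivative of [phi]
    composed with multiplication, taken in the second factor at the identity. It has order [k]
    because the composite [F] has order [k.+1]. *)
Lemma left_field_smooth xi : tangent 1%g xi -> smooth_field (left_field (G := G) xi).
Proof.
move=> Txi; split=> [p|phi sphi e Ae].
  by have := tangent_tleft p Txi; rewrite mulg1.
have [c [w [Ac c1 ->]]] := Txi.
have [_ ie pe _ _] := atlas_chart e Ae.
set F := phi \o (fun q : G * G => (q.1 * q.2)%g) \o param (prod_chart e c).
have -> : (fun p => left_field (coord_deriv c 1%g w) p phi) \o param e =
    'D_(row_mx 0 w) F \o (fun y => row_mx y (coord c 1%g)).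
  apply/funext => y /=; rewrite /left_field /tleft /tmap /coord_deriv !asboolT //.
    rewrite derive_row_mxr; congr (derive _ _ _); apply/funext => z.
    by rewrite /F /= row_mxKl row_mxKr.
  exact: smooth_fun_mulgl.
apply: (@smooth_comp _ _ _ _ (cimg (prod_chart e c))) => //.
- by move=> _ [x cx <-]; exact: cimg_prod.
- exact: smooth_row_mxl.
- by move=> k; have [_] := smooth_fun_mulg sphi Ae Ac k.+1; exact.
Qed.

End LeftTranslation.

(** * Orthogonal projection *)

Section Subspaces.
Variables (R : realType) (V : lmodType R).
Implicit Types (A B : set V) (u v : V).

Lemma subspaceD A u v : is_subspace A -> A u -> A v -> A (u + v).
Proof. by move=> [_ AL] Au Av; rewrite -[u]scale1r; exact: AL. Qed.

Lemma subspaceZ A (a : R) u : is_subspace A -> A u -> A (a *: u).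
Proof. by move=> [A0 AL] Au; rewrite -[_ *: _]addr0; exact: AL. Qed.

Lemma subspaceB A u v : is_subspace A -> A u -> A v -> A (u - v).
Proof.
by move=> sA Au Av; apply: subspaceD => //; rewrite -scaleN1r; exact: subspaceZ.
Qed.

Lemma subspace_sum A (I : Type) (s : seq I) (F : I -> V) :
  is_subspace A -> (forall i, A (F i)) -> A (\sum_(i <- s) F i).
Proof.
move=> sA AF; elim/big_rec: _ => [|i x _ Ax]; first by case: sA.
exact: subspaceD.
Qed.

Lemma span_fam_sub A k (f : 'I_k -> V) :
  is_subspace A -> (forall i, A (f i)) -> span_fam f `<=` A.
Proof.
by move=> sA Af _ [a ->]; apply: subspace_sum => // i; exact: subspaceZ.
Qed.

Lemma span_fam_subspace k (f : 'I_k -> V) : is_subspace (span_fam f).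
Proof.
split; first by exists (fun=> 0); rewrite big1 // => i _; rewrite scale0r.
move=> a _ _ [x ->] [y ->]; exists (fun i => a * x i + y i).
rewrite scaler_sumr -big_split /=; apply: eq_bigr => i _.
by rewrite scalerDl scalerA.
Qed.

Lemma span_fam_mem k (f : 'I_k -> V) i : span_fam f (f i).
Proof.
exists (fun j => (j == i)%:R); rewrite (bigD1 i) //= eqxx scale1r big1 ?addr0 //.
by move=> j /negPf ->; rewrite scale0r.
Qed.

End Subspaces.

Section InnerProduct.
Variables (R : realType) (V : lmodType R) (T : set V) (B : V -> V -> R).
Hypothesis subspace_T : is_subspace T.
Hypothesis B_sym : forall u v, T u -> T v -> B u v = B v u.
Hypothesis B_linl : forall (a : R) u v w, T u -> T v -> T w ->
  B (a *: u + v) w = a * B u w + B v w.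
Hypothesis B_pos : forall u, T u -> u != 0 -> 0 < B u u.

Lemma inner_linr (a : R) u v w :
  T u -> T v -> T w -> B w (a *: u + v) = a * B w u + B w v.
Proof.
move=> Tu Tv Tw; have [_ TL] := subspace_T.
by rewrite B_sym ?B_linl ?(@B_sym w) //; exact: TL.
Qed.

Lemma inner0r u : T u -> B u 0 = 0.
Proof.
move=> Tu; have [T0 _] := subspace_T.
by have := inner_linr (-1) T0 T0 Tu; rewrite scaler0 addr0 mulN1r addNr.
Qed.

Lemma innerBl u v w : T u -> T v -> T w -> B (u - v) w = B u w - B v w.
Proof. by move=> Tu Tv Tw; rewrite addrC -scaleN1r B_linl // mulN1r addrC. Qed.

Lemma innerBr u v w : T u -> T v -> T w -> B w (u - v) = B w u - B w v.
Proof. by move=> Tu Tv Tw; rewrite addrC -scaleN1r inner_linr // mulN1r addrC. Qed.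

Lemma inner_ge0 u : T u -> 0 <= B u u.
Proof.
move=> Tu; have [->|u0] := eqVneq u 0; last by rewrite ltW ?B_pos.
by rewrite inner0r //; case: subspace_T.
Qed.

Lemma inner_eq0 u : T u -> B u u <= 0 -> u = 0.
Proof.
by move=> Tu; have [//|u0] := eqVneq u 0; rewrite leNgt B_pos.
Qed.

(** Gram-Schmidt by induction on the number of generators, which may be dependent. [B] is an inner
    product on [T] only, as a metric is on a tangent space among all functionals, so membership in
    [T] accompanies every expansion. *)
Lemma orthogonal_projection r (e : 'I_r -> V) v :
  (forall i, T (e i)) -> T v ->
  exists2 p, span_fam e p & forall u, span_fam e u -> B (v - p) u = 0.
Proof.
elim: r e v => [|r IH] e v Te Tv.
  exists 0; first by case: (span_fam_subspace e).
  by move=> _ [a ->]; rewrite big_ord0 inner0r // subr0.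
pose e' i := e (widen_ord (leqnSn r) i); pose x := e ord_max.
have Te' i : T (e' i) by exact: Te.
have Tspan u : span_fam e' u -> T u by apply: span_fam_sub.
have se' := span_fam_subspace e'; have se := span_fam_subspace e.
have e'e : span_fam e' `<=` span_fam e.
  by apply: span_fam_sub => // i; exact: span_fam_mem.
have [px px_e' px_orth] := IH e' x Te' (Te _).
have [pv pv_e' pv_orth] := IH e' v Te' Tv.
set x' := x - px in px_orth *; set c := B (v - pv) x' / B x' x'.
have Tx' : T x' by apply: subspaceB => //; [exact: Te|exact: Tspan].
have Tvpv : T (v - pv) by apply: subspaceB => //; exact: Tspan.
have cE : B (v - pv) x' = c * B x' x'.
  (* If the last generator already lies in the span of the others, both sides vanish whatever [c]
     is. *)
  have [x0|x0] := eqVneq x' 0; first by rewrite x0 !inner0r ?mulr0 //; case: subspace_T.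
  by rewrite /c divfK // gt_eqF // B_pos.
exists (c *: x' + pv).
  have [_ seL] := se; apply: seL; last exact: e'e.
  by apply: subspaceB; [|exact: span_fam_mem|exact: e'e].
move=> _ [a ->]; rewrite big_ord_recr /=.
set u' := \sum_(i < r) _; pose u := a ord_max *: px + u'.
have u'_e' : span_fam e' u' by exists (fun i => a (widen_ord (leqnSn r) i)).
have u_e' : span_fam e' u by case: se' => _; apply.
(* The test vector is regrouped into a multiple of [x'] and a vector of the smaller span, which is
   orthogonal to both [x'] and [v - pv]. *)
have -> : u' + a ord_max *: e ord_max = a ord_max *: x' + u.
  by rewrite /u /x' addrA -scalerDr subrK addrC.
have -> : v - (c *: x' + pv) = (- c) *: x' + (v - pv).
  by rewrite scaleNr opprD addrCA.
have Tu := Tspan _ u_e'.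
have Tw : T (- c *: x' + (v - pv)) by case: subspace_T => _; apply.
rewrite inner_linr // !B_linl // (pv_orth u) // (px_orth u) // cE.
by rewrite mulNr addNr mulr0 mulr0 !addr0.
Qed.

(** With [p] the projection of [v] and [w = v - p], Pythagoras gives |q s - v|^2 = |q s - p|^2 +
    |w|^2. Thus |w| is a lower bound of quantities tending to 0, and [v = p]. *)
Lemma span_closed (r : nat) (e : 'I_r -> V) (F : set_system R) (FF : ProperFilter F)
    (q : R -> V) (v : V) :
  (forall i, T (e i)) -> T v -> (\forall s \near F, span_fam e (q s)) ->
  Num.sqrt (B (q s - v) (q s - v)) @[s --> F] --> 0 -> span_fam e v.
Proof.
move=> Te Tv qe q0; have [p pe p_orth] := orthogonal_projection Te Tv.
have Tspan u : span_fam e u -> T u by apply: span_fam_sub.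
have Tp := Tspan _ pe; set w := v - p in p_orth.
have Tw : T w by exact: subspaceB.
suff w0 : w = 0 by rewrite -[v](subrK p) -/w w0 add0r.
apply: inner_eq0 => //; rewrite -sqrtr_eq0 eq_le sqrtr_ge0 andbT.
have T0 : T 0 by case: subspace_T.
suff : \forall s \near F, Num.sqrt (B w w) <= Num.sqrt (B (q s - v) (q s - v)).
  exact: cvgr_to_ge.
apply: filterS qe => s qs; apply: ler_wsqrtr.
have qp_e : span_fam e (q s - p) by apply: subspaceB => //; exact: span_fam_subspace.
have Tqp := Tspan _ qp_e.
have -> : q s - v = (q s - p) - w by rewrite /w opprB addrA subrK.
have Td := subspaceB subspace_T Tqp Tw.
rewrite innerBl // (innerBr Tqp Tw Tqp) (innerBr Tqp Tw Tw).
rewrite (B_sym Tqp Tw) (p_orth _ qp_e) subr0 sub0r opprK.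
by rewrite lerDr inner_ge0.
Qed.

End InnerProduct.

(** * Trajectories, submersions and connections *)

(** One-sided limits at the endpoints are meaningful: from [t] one moves by [e / 2] to the right,
    cut off at [b], or, when [t] is [b], to the left, cut off at [a]. *)
Lemma within_dnbhs_itv_proper (R : realType) (a b t : R) :
  a < b -> `[a, b]%classic t -> ProperFilter (within `[a, b]%classic t^').
Proof.
move=> ab tab; apply: Build_ProperFilter_ex => P /nbhs_ballP[e /= e0 eP].
have /= /andP[ta tb] : a <= t <= b by move: tab; rewrite /= in_itv.
have e20 : 0 < e / 2 by rewrite divr_gt0.
have e2e : e / 2 < e by rewrite gtr_pMr // invf_lt1 // ltr1n.
have [tltb|] := ltP t b.
  pose s := Num.min b (t + e / 2); exists s.
  have ts : t < s by rewrite lt_min tltb ltrDl.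
  have bs : ball t e s.
    rewrite /ball /= ltr0_norm ?subr_lt0 // opprB ltrBlDl.
    by rewrite gt_min ltrD2l e2e orbT.
  apply: (eP s bs); first by rewrite gt_eqF.
  by rewrite /= in_itv /= (le_trans ta (ltW ts)) ge_min lexx.
move=> bt; pose s := Num.max a (t - e / 2); exists s.
have ts : s < t by rewrite gt_max (lt_le_trans ab bt) ltrBlDr ltrDl.
have bs : ball t e s.
  rewrite /ball /= gtr0_norm ?subr_gt0 // ltrBlDr -ltrBlDl lt_max.
  by rewrite ltrD2l ltrN2 e2e orbT.
apply: (eP s bs); first by rewrite lt_eqF.
by rewrite /= in_itv /= le_max lexx (le_trans (ltW ts) tb).
Qed.

Lemma cvg_addl (R : realType) (a t : R) : a + s @[s --> t] --> a + t.
Proof. by apply: cvgD; [exact: cvg_cst|exact: cvg_id]. Qed.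

Lemma cvg_shift_within_nbhs (R : realType) (a b t : R) :
  (a + s) @[s --> within `[0, b - a]%classic (nbhs t)] -->
  within `[a, b]%classic (nbhs (a + t)).
Proof.
move=> P /(@cvg_addl _ a t) nP; apply: (@filterS _ (nbhs t) _ _ _ _ nP) => s /= Ps.
by rewrite in_itv /= => /andP[s0 sb]; apply: Ps; rewrite in_itv /= lerDl s0 -lerBrDl.
Qed.

Lemma cvg_shift_within_dnbhs (R : realType) (a b t : R) :
  (a + s) @[s --> within `[0, b - a]%classic t^'] -->
  within `[a, b]%classic (a + t)^'.
Proof.
move=> P /(@cvg_addl _ a t) nP; apply: (@filterS _ (nbhs t) _ _ _ _ nP) => s /= Ps st.
rewrite in_itv /= => /andP[s0 sb]; apply: Ps; first by rewrite (inj_eq (addrI a)).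
by rewrite in_itv /= lerDl s0 -lerBrDl.
Qed.

Section Trajectories.
Variables (R : realType) (n : nat) (G : lieGroupType R n).
Variable met : G -> functional G R -> functional G R -> R.

(** The equation [E] is autonomous, so time can be translated. This is required because
    [flow_invariant] speaks of trajectories that start at time 0. *)
Lemma trajectory_shift (E : G -> functional G R -> functional G R -> Prop)
    (a b : R) (g : R -> G) (xi : R -> functional G R) :
  trajectory met E a b g xi ->
  trajectory met E 0 (b - a) (g \o +%R a) (xi \o +%R a).
Proof.
move=> tr t; rewrite /= in_itv /= => /andP[t0 tb].
have tab : `[a, b]%classic (a + t) by rewrite /= in_itv /= lerDl t0 -lerBrDl.
have diff_shift s : a + s - (a + t) = s - t by rewrite opprD addrACA subrr add0r.
have [Txi [cg vg] [dxi [Tdxi hdxi Edxi]]] := tr _ tab.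
split=> //; [split|exists dxi; split=> //].
- exact: cvg_comp (@cvg_shift_within_nbhs _ a b t) cg.
- move=> phi sphi.
  have := cvg_comp _ _ (@cvg_shift_within_dnbhs _ a b t) (vg phi sphi).
  by apply: cvg_trans; apply: near_eq_cvg; near=> s; rewrite /= diff_shift.
- have := cvg_comp _ _ (@cvg_shift_within_dnbhs _ a b t) hdxi.
  by apply: cvg_trans; apply: near_eq_cvg; near=> s; rewrite /= diff_shift.
Unshelve. all: by end_near. Qed.

End Trajectories.

Section Submersion.
Variables (R : realType) (n k : nat) (G : lieGroupType R n) (H : manifoldType R k).
Variables (K : set G) (pi : G -> H).
Variable met : G -> functional G R -> functional G R -> R.
Hypothesis met_riem : riemannian_metric met.

Lemma tmap_linear (a : R) (u v : functional G R) :
  tmap pi (a *: u + v) = a *: tmap pi u + tmap pi v.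
Proof.
apply/funext => phi; rewrite /tmap !fctE; case: asboolP => // _.
by rewrite scaler0 addr0.
Qed.

Lemma vertical_subspace p : is_subspace (vertical pi p).
Proof.
have [T0 TL] := @tangent_subspace _ _ G p; split.
  by split=> //; apply/funext => phi; rewrite /tmap; case: asboolP.
move=> a u v [Tu u0] [Tv v0]; split; first exact: TL.
by rewrite tmap_linear u0 v0 scaler0 addr0.
Qed.

Lemma horizontal_subspace p : is_subspace (horizontal pi met p).
Proof.
have [msym mlin mpos _] := met_riem; have sT := @tangent_subspace _ _ G p.
have [T0 TL] := sT; split=> [|a u v [Tu u0] [Tv v0]].
  split=> // w [Tw _]; rewrite msym //.
  by apply: (inner0r sT (msym p) (mlin p)) Tw.
split=> [|w vw]; first exact: TL.
by have [Tw _] := vw; rewrite mlin // u0 // v0 // mulr0 addr0.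
Qed.

(** Such a vector is orthogonal to itself. *)
Lemma horizontal_vertical_eq0 p v :
  horizontal pi met p v -> vertical pi p v -> v = 0.
Proof.
move=> [Tv hv] vv; have [msym mlin mpos _] := met_riem.
by apply/eqP/negPn/negP => /(mpos p v Tv); rewrite hv // ltxx.
Qed.

(** A curve in [K] through the identity is sent by [pi] to a single point, so every difference
    quotient of [phi \o pi] along it is 0. *)
Lemma lie_algebra_vertical :
  quotient_manifold K pi -> lie_algebra K `<=` vertical pi 1%g.
Proof.
move=> [_ piE _ _] v [Tv [gamma [g0 gK [_ vel]]]]; split=> //.
apply/funext => phi; rewrite /tmap; case: asboolP => // _.
(* Tangent vectors vanish on functions that are not smooth, so there is no need
   to know that [phi \o pi] is smooth. *)
have [sphi|nsphi] := pselect (smooth_fun (phi \o pi)); last first.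
  by have [c [w [_ _ ->]]] := Tv; rewrite /coord_deriv asboolF.
have := vel _ sphi; rewrite withinET => vphi.
apply: (cvg_unique (@norm_hausdorff _ _) vphi).
apply: cvg_near_cst; near=> s; rewrite /= g0.
have -> : pi (gamma s) = pi 1%g by apply/esym/piE; rewrite invg1 mul1g.
by rewrite subrr mul0r.
Unshelve. all: by end_near. Qed.

(* [tmap pi] is injective on horizontal vectors, so lifting a local frame of
   [D] bounds the dimension of [d]. *)
Lemma horizontal_lift_span r (D : H -> set (functional H R))
    (d : set (functional G R)) p :
  is_distribution r D -> is_subspace d -> d `<=` horizontal pi met p ->
  tmap pi @` d = D (pi p) ->
  exists e : 'I_r -> functional G R, d = span_fam e.
Proof.
move=> distr sd dh dD; have [X [_ /nbhs_singleton [_ DX]]] := distr (pi p).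
have lift i : exists e, d e /\ tmap pi e = X i (pi p).
  have : D (pi p) (X i (pi p)) by rewrite DX; exact: (span_fam_mem (X^~ (pi p))).
  by rewrite -dD => -[e de eX]; exists e.
have [e /all_and2 [de eX]] := choice lift; exists e.
apply/seteqP; split=> [v dv|]; last exact: span_fam_sub.
have : D (pi p) (tmap pi v) by rewrite -dD; exists v.
rewrite DX => -[a va]; exists a; apply/eqP; rewrite -subr_eq0; apply/eqP.
have dw : d (\sum_i a i *: e i) by apply: subspace_sum => // i; exact: subspaceZ.
have dvw := subspaceB sd dv dw.
apply: (horizontal_vertical_eq0 (dh _ dvw)); split; first by case: (dh _ dvw).
have sum_lift : tmap pi (\sum_i a i *: e i) = \sum_i a i *: X i (pi p).
  elim/big_rec2: _ => [|i x y _ xy].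
    by apply/funext => phi; rewrite /tmap; case: asboolP.
  by rewrite tmap_linear eX xy.
by rewrite addrC -scaleN1r tmap_linear sum_lift va scaleN1r addNr.
Qed.

End Submersion.

Section Connections.
Variables (R : realType) (n : nat) (G : lieGroupType R n).
Variable met : G -> functional G R -> functional G R -> R.
Variable nab : (G -> functional G R) -> (G -> functional G R) -> G -> functional G R.
Hypothesis nab_LC : levi_civita met nab.

Lemma lie_conn_tangent xi eta :
  tangent 1%g xi -> tangent 1%g eta -> tangent 1%g (lie_conn nab xi eta).
Proof.
move=> Txi Teta; have [[smooth_nab _ _ _] _ _] := nab_LC.
by have [] := smooth_nab _ _ (left_field_smooth Txi) (left_field_smooth Teta).
Qed.

(** The left-invariant field of 0 is the zero field Z, and Z + Z = Z; additivity of the connection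
    then makes its value on Z equal to its own double. *)
Lemma lie_conn0r xi : tangent 1%g xi -> lie_conn nab xi 0 = 0.
Proof.
move=> Txi; have [[_ _ nabD _] _ _] := nab_LC; have [T0 _] := @tangent_subspace _ _ G 1%g.
have lf0 : left_field (0 : functional G R) = fun=> 0.
  apply/funext => p; apply/funext => phi.
  by rewrite /left_field /tleft /tmap; case: asboolP.
have s0 := left_field_smooth T0.
have := nabD _ _ _ (left_field_smooth Txi) s0 s0 1%g.
have -> : (fun q => left_field (0 : functional G R) q + left_field 0 q) = left_field 0.
  by apply/funext => q; rewrite lf0 addr0.
rewrite -[LHS]addr0; rewrite /lie_conn => /addrI; exact: esym.
Qed.

End Connections.

(** * From the closed-loop system to the constrained equations *)

Theorem theorem7 (R : realType) (n k m r : nat)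
  (* the homogeneous space H = G/K *)
  (G : lieGroupType R n) (H : manifoldType R k) (K : set G) (pi : G -> H)
  (G_connected : connected [set: G])
  (K_closed : closed_subgroup K)
  (H_quotient : quotient_manifold K pi)
  (* the metrics *)
  (metG : G -> functional G R -> functional G R -> R)
  (metH : H -> functional H R -> functional H R -> R)
  (metG_riem : riemannian_metric metG)
  (metG_left : left_invariant metG)
  (metH_riem : riemannian_metric metH)
  (pi_submersion : riemannian_submersion pi metG metH)
  (* the Levi-Civita connection of G *)
  (nab : (G -> functional G R) -> (G -> functional G R) -> G -> functional G R)
  (nab_LC : levi_civita metG nab)
  (* the potential and the gradient of its lift to G *)
  (V : H -> R) (V_smooth : smooth_fun V)
  (gradV : G -> functional G R)
  (gradV_grad : is_gradient metG (V \o pi) gradV)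
  (* the non-integrable invariant distribution and the subspace d of h *)
  (D : H -> set (functional H R))
  (D_distr : is_distribution r D)
  (D_nonint : ~ integrable_distribution r D)
  (D_inv : invariant_distribution pi D)
  (d : set (functional G R))
  (d_sub : is_subspace d)
  (d_hor : d `<=` horizontal pi metG 1%g)
  (d_D : tmap pi @` d = D (pi 1%g))
  (* the control directions *)
  (Y : 'I_m -> H -> functional H R)
  (Y_smooth : forall c, smooth_field (Y c))
  (Y_inv : forall c, invariant_field pi (Y c))
  (f : 'I_m -> functional G R)
  (f_hor : forall c, horizontal pi metG 1%g (f c))
  (f_Y : forall c, tmap pi (f c) = Y c (pi 1%g))
  (f_indep : lin_indep f)
  (hfd : direct_sum (horizontal pi metG 1%g) (span_fam f) d)
  (* the control law *)
  (U : set 'rV[R]_m) (ustar : functional G R -> 'rV[R]_m)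
  (ustar_law : control_law U d ustar)
  (ustar_vnc : flow_invariant metG d
     (closed_loop_eq (lie_conn nab) gradV f ustar))
  (ustar_unique : forall u : functional G R -> 'rV[R]_m,
     control_law U d u ->
     flow_invariant metG d (closed_loop_eq (lie_conn nab) gradV f u) ->
     forall xi, d xi -> u xi = ustar xi)
  (* the projections of T_e G = d (+) (f (+) s) *)
  (pd pf : functional G R -> functional G R)
  (pd_pf : projections (tangent 1%g) d
     (sum_set (span_fam f) (lie_algebra K)) pd pf)
  (a b : R) (ab : a < b) (g : R -> G) (xi : R -> functional G R) :
  trajectory metG (closed_loop_eq (lie_conn nab) gradV f ustar) a b g xi ->
  d (xi a) ->
  trajectory metG
    (constrained_eq (constrained_conn (lie_conn nab) pf) gradV pd) a b g xi.
Proof.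
move=> tr xia.
have [msym mlin mpos _] := metG_riem.
have sT := @tangent_subspace _ _ G 1%g.
have sf := span_fam_subspace f.
have d_T : d `<=` tangent 1%g by move=> v /d_hor[].
have K_vert := lie_algebra_vertical H_quotient.
have [_ f_cap_d] := hfd.
(* Directness of the sum of [d] with [f] and the vertical space: [S = y - F] is horizontal as well
   as vertical, hence 0, and then [y = F] lies in the intersection of [f] and [d]. *)
have fs_cap_d y F S : d y -> span_fam f F -> vertical pi 1%g S -> y = F + S -> y = 0.
  move=> dy fF vS yE.
  have S0 : S = 0.
    apply: (horizontal_vertical_eq0 metG_riem) (vS).
    have -> : S = y - F by rewrite yE addrAC subrr add0r.
    apply: subspaceB; [exact: horizontal_subspace|exact: d_hor|].
    by apply: (span_fam_sub _ _ fF) => //; exact: horizontal_subspace.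
  suff : [set 0] y by [].
  by rewrite -f_cap_d; split=> //; rewrite yE S0 addr0.
have [e dE] := horizontal_lift_span metG_riem D_distr d_sub d_hor d_D.
have xi_d t : `[a, b]%classic t -> d (xi t).
  rewrite /= in_itv /= => /andP[ta tb].
  have [_ inv] := ustar_vnc.
  (* Invariance is applied to the trajectory translated to [[0, b - a]], at time [t - a]. *)
  rewrite -[t](subrKC a); apply: (inv _ _ _ _ (trajectory_shift tr)).
  - by rewrite subr_gt0.
  - by rewrite /= addr0.
  - by rewrite /= in_itv /= subr_ge0 ta lerD2r.
move=> t tab; have [Txi vel [dxi [Tdxi hdxi eq_dxi]]] := tr t tab.
split=> //; exists dxi; split=> //.
(* For [s] in [[a, b]] the difference quotients of [xi] lie in [d], the span of the finite family
   [e], so their limit does too. *)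
have dxi_d : d dxi.
  have Te i : tangent 1%g (e i) by apply: d_T; rewrite dE; exact: span_fam_mem.
  have pF := within_dnbhs_itv_proper ab tab.
  rewrite dE; apply: (span_closed sT (msym _) (mlin _) (mpos _) pF Te Tdxi _ hdxi).
  apply: filterS (withinT _ _) => s sab; rewrite -dE; apply: subspaceZ => //.
  by apply: subspaceB => //; exact: xi_d.
have xid := xi_d t tab.
have proj x : tangent 1%g x -> exists F S,
    [/\ span_fam f F, vertical pi 1%g S, d (pd x), pf x = F + S & x = pd x + pf x].
  move=> Tx; have [dp [F fF [S sS FS]] xE] := pd_pf _ Tx.
  by exists F, S; split=> //; exact: K_vert.
(* As the difference of [xi t] and [pd (xi t)], this vector lies in [d]; it is also a sum of a
   control direction and a vertical vector. *)
have pf_xi : pf (xi t) = 0.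
  have [F [S [fF vS dp pfE xE]]] := proj _ Txi.
  apply: (fs_cap_d _ F S _ fF vS pfE).
  have -> : pf (xi t) = xi t - pd (xi t) by rewrite [X in _ = X - _]xE addrAC subrr add0r.
  exact: subspaceB.
rewrite /constrained_eq /constrained_conn pf_xi (lie_conn0r nab_LC Txi) sub0r.
set X := lie_conn nab (xi t) (xi t); set W := tleft _ _.
have TX : tangent 1%g X by exact: (lie_conn_tangent nab_LC).
have TW : tangent 1%g W.
  by have := tangent_tleft (g t)^-1%g (gradV_grad (g t)).1; rewrite mulVg.
have [FX [SX [fFX vSX dX pfX XE]]] := proj _ TX.
have [FW [SW [fFW vSW dW pfW WE]]] := proj _ TW.
have fu : span_fam f (\sum_c ustar (xi t) 0 c *: f c) by exists (ustar (xi t) 0).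
(* Since [pf (xi t) = 0], the constrained connection has been reduced to [X - pf X], the
   [d]-component of [X]. *)
have XpE : X - pf X = pd X by rewrite {1}XE addrK.
rewrite XpE.
(* The left-hand side of the constrained equation lies in [d]. By the closed-loop equation it equals
   the control term minus [pf X] and [pf W], which is split here into its part along [f] and its
   vertical part. *)
apply: (fs_cap_d _ (\sum_c ustar (xi t) 0 c *: f c - FX - FW) (- SX - SW)).
- exact: (subspaceD d_sub (subspaceD d_sub dxi_d dX) dW).
- exact: (subspaceB sf (subspaceB sf fu fFX) fFW).
- have sv := @vertical_subspace _ _ _ _ _ pi 1%g.
  by rewrite -[X in X - _]sub0r; exact: (subspaceB sv (subspaceB sv sv.1 vSX) vSW).
rewrite -eq_dxi -/X -/W.
move: XE WE; rewrite pfX pfW; move: (pd X) (pd W) => PX PW -> ->.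
by apply/funext => phi; rewrite !fctE; ring.
Qed.
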